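(* As $\varepsilon\to 0$ (with $\varepsilon \ge 0$), $$\psi(1+\varepsilon)\leq 1+\sqrt[4]{8\varepsilon}+O(\varepsilon^{1/2}).$$ That is, there exist constants $C>0$ and $\varepsilon_0>0$ such that $\psi(1+\varepsilon)\le 1+(8\varepsilon)^{1/4}+C\varepsilon^{1/2}$ for all $0\le\varepsilon\le\varepsilon_0$.
   Context: For a complex Hilbert space $H$ with inner product $\langle\cdot,\cdot\rangle$ and norm $\|\cdot\|$, $\mathcal{B}(H)$ denotes the algebra of bounded linear operators on $H$, with operator norm $\|A\|=\sup\{\|Ah\| : h\in H,\ \|h\|=1\}$. The numerical radius of $A\in\mathcal{B}(H)$ is $w(A)=\sup\{|\langle Ah,h\rangle| : h\in H,\ \|h\|=1\}$. For real $r\ge 1$, define $$\psi(r)=\sup\{\|A\| : A\in\mathcal{B}(H),\ A \text{ invertible},\ w(A)\leq r,\ w(A^{-1})\leq r\},$$ where the supremum is also taken over all complex Hilbert spaces $H$. *)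

(* Defs.v *)
From HB Require Import structures.
From mathcomp Require Import all_boot all_order all_algebra sesquilinear.
From mathcomp Require Import complex.
From mathcomp Require Import all_classical all_reals all_analysis.
Set Implicit Arguments.
Unset Strict Implicit.
Unset Printing Implicit Defensive.
Import Order.TTheory GRing.Theory Num.Theory.
Import numFieldNormedType.Exports.

Local Open Scope classical_set_scope.
Local Open Scope complex_scope.
Local Open Scope ring_scope.

(* Complex scalars are R[i] for an arbitrary R : realType.
   The inner product is linear in its first argument and conjugate-linear in
   its second one. *)
HB.mixin Record isHilbert (R : realType) (H : Type)
    of CompleteNormedModule R[i] H := {
  inner : {dot H for @Num.conj R[i]};
  inner_normE : forall h : H, inner h h = `|h| ^+ 2
}.

#[short(type="hilbertType")]
HB.structure Definition Hilbert (R : realType) :=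
  {H of isHilbert R H & CompleteNormedModule R[i] H}.

(* Norms in a module over R[i] are R[i]-valued (nonnegative reals embedded in
   R[i]); this is the same norm as an element of R. It applies both to vectors
   and to scalars z : R[i], where it is the modulus. *)
Definition rnorm (R : realType) (V : normedZmodType R[i]) (v : V) : R :=
  complex.Re `|v|.

Definition bounded_op (R : realType) (H : hilbertType R)
    (A : {linear H -> H}) : Prop :=
  exists M : R, forall h : H, rnorm (A h) <= M * rnorm h.

(* On a bounded operator the next two suprema are over bounded sets of reals.
   These sets are empty only for the zero space, where sup set0 = 0 gives the
   usual convention. *)
Definition op_norm (R : realType) (H : hilbertType R)
    (A : {linear H -> H}) : R :=
  sup [set rnorm (A h) | h in [set h : H | rnorm h = 1]].

Definition numerical_radius (R : realType) (H : hilbertType R)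
    (A : {linear H -> H}) : R :=
  sup [set rnorm (inner (A h) h) | h in [set h : H | rnorm h = 1]].

Definition inverse_op (R : realType) (H : hilbertType R)
    (A B : {linear H -> H}) : Prop :=
  cancel A B /\ cancel B A.

(* B plays the role of the inverse of A in the algebra of bounded operators.
   The supremum is extended-real so that an unbounded set is not sent to a
   default real value. *)
Definition psi (R : realType) (r : R) : \bar R :=
  ereal_sup [set x : \bar R |
    exists (H : hilbertType R) (A B : {linear H -> H}),
      [/\ bounded_op A, bounded_op B & inverse_op A B] /\
      [/\ numerical_radius A <= r, numerical_radius B <= r &
          x = (op_norm A)%:E]].

(* Main.v *)
Require Import Defs.
From HB Require Import structures.
From mathcomp Require Import all_boot all_order all_algebra sesquilinear.
From mathcomp Require Import complex.
From mathcomp Require Import all_classical all_reals all_analysis.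
From mathcomp Require Import cyclic separable cyclotomic ring lra zify.
Import Order.TTheory GRing.Theory Num.Theory.
Import numFieldNormedType.Exports.
Local Open Scope ring_scope.

(** Fix a unit vector x and put s = |A x| and u_k = A^k x / |A^k x| for every
integer k. Averaging e^{i theta} <A h, h> and e^{i theta} <h, A^-1 h> over the
vectors h = sum_k d_k e^{i k theta} u_k, theta running over roots of unity of
large order, leaves only the terms
  d_k d_{k+1} (rho_k + 1 / rho_k),  rho_k = |A u_k|,
so that sum_k d_k d_{k+1} (rho_k + 1 / rho_k) <= 2 r sum_k d_k^2 as soon as
w(A) <= r and w(A^-1) <= r. Now rho_k + 1 / rho_k >= 2 always, while rho_0 = s.
Taking d_k = q^j with j the distance from k to {0, 1} and 0 <= q < 1, this gives
  (s + 1 / s) (1 - q^2) <= 4 (r - q).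
For r = 1 + eps and q = 1 - sqrt (2 eps) the right-hand side is of the right
order, and solving the quadratic inequality in s yields
s <= 1 + (8 eps)^{1/4} + O(eps^{1/2}). *)

(** * Roots of unity and finite sums *)

(** ['X^n - 1] splits, and is separable since [n] is nonzero in [F]; having [n] distinct roots
    forces a primitive one among them. *)
Lemma closed_prim_root_exists (F : closedFieldType) n :
  n%:R != 0 :> F -> exists w : F, n.-primitive_root w.
Proof.
case: n => [|n]; first by rewrite eqxx.
move=> n_neq0; pose p : {poly F} := 'X^(n.+1) - 1.
have [r Dp] := closed_field_poly_normal p.
rewrite (monicP _) ?monicXnsubC // scale1r in Dp.
have rn1 : all n.+1.-unity_root r.
  by apply/allP=> z; rewrite -root_prod_XsubC -Dp.
have sz_r : (n.+1 < (size r).+1)%N.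
  by rewrite -(size_prod_XsubC r id) -Dp size_XnsubC.
have [|w] := hasP (has_prim_root (ltn0Sn n) rn1 _ sz_r); last by exists w.
by rewrite -separable_prod_XsubC -Dp separable_Xn_sub_1.
Qed.

Lemma sum_expr_unity_root (F : fieldType) n (z : F) :
  z ^+ n = 1 -> z != 1 -> \sum_(l < n) z ^+ l = 0.
Proof.
move=> zn1 z1; apply: (mulfI (x := z - 1)); first by rewrite subr_eq0.
by rewrite -subrX1 zn1 subrr mulr0.
Qed.

Lemma norm_prim_root (F : numDomainType) n (w : F) :
  n.-primitive_root w -> `|w| = 1.
Proof.
move=> wP; apply/eqP; rewrite -(pexpr_eq1 (prim_order_gt0 wP)) //.
by rewrite -normrX (prim_expr_order wP) normr1.
Qed.

Lemma conj_prim_root (F : numClosedFieldType) n (w : F) :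
  n.-primitive_root w -> w^* = w^-1.
Proof.
by move=> wP; rewrite invC_norm (norm_prim_root _ _ _ wP) expr1n invr1 mul1r.
Qed.

Lemma sum_band (V : nmodType) (f : nat -> nat -> V) m :
  \sum_(j < m.+1) \sum_(k < m.+1 | j.+1 == k) f j k = \sum_(j < m) f j j.+1.
Proof.
rewrite big_ord_recr /= [X in _ + X]big_pred0 ?addr0; last first.
  by move=> k; apply/negbTE; rewrite neq_ltn ltnS leq_ord orbT.
apply: eq_bigr => j _.
pose k0 : 'I_m.+1 := Ordinal (ltn_ord j : (j.+1 < m.+1)%N).
by rewrite (big_pred1 k0) // => k; rewrite eq_sym.
Qed.

(** Serves to sum the links of a two-sided orbit, whose weights are symmetric about the central link
    [N]. *)
Lemma sum_two_sided (V : nmodType) (f g : nat -> V) (c : V) N :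
  (forall j, (j < N)%N -> f (N - j.+1)%N = g j) ->
  (forall j, (j < N)%N -> f (N.+1 + j)%N = g j) ->
  f N = c -> \sum_(j < N + N.+1) f j = (\sum_(j < N) g j) *+ 2 + c.
Proof.
move=> fl fr <-; rewrite big_split_ord big_ord_recl /= addn0.
rewrite mulr2n addrAC addrA; congr (_ + _ + _).
  rewrite (reindex_inj rev_ord_inj); apply: eq_bigr => j _ /=.
  exact: fl (ltn_ord j).
by apply: eq_bigr => j _; rewrite /bump /= add1n addnS -addSn fr.
Qed.

(** * Averaging inner products over roots of unity *)

Section HilbertOperators.
Context {R : realType} {H : hilbertType R}.
Local Notation C := R[i].
Implicit Types (F G A B : {linear H -> H}) (v : nat -> H).

Lemma inner_suml (I : Type) (s : seq I) (P : pred I) (E : I -> H) (h : H) :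
  inner (\sum_(i <- s | P i) E i) h = \sum_(i <- s | P i) inner (E i) h.
Proof. exact: linear_sumlz. Qed.

Lemma inner_sumr (I : Type) (s : seq I) (P : pred I) (E : I -> H) (h : H) :
  inner h (\sum_(i <- s | P i) E i) = \sum_(i <- s | P i) inner h (E i).
Proof. exact: linear_sumr. Qed.

(** Orthogonality of characters: the pair [(j, k)] carries a geometric sum of powers of
    [w ^+ (j + e) / w ^+ k]. Both [j + e] and [k] stay below the order [n.+1], so congruence of
    exponents is equality and no wrap-around term survives. *)
Lemma fourier_inner F G v n e (w : C) : (e <= 1)%N -> n.+1.-primitive_root w ->
  let h l := \sum_(j < n) (w ^+ l) ^+ j *: v j in
  \sum_(l < n.+1) (w ^+ l) ^+ e * inner (F (h l)) (G (h l)) =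
  n.+1%:R *
  \sum_(j < n) \sum_(k < n | (j + e)%N == k) inner (F (v j)) (G (v k)).
Proof.
move=> e1 wP h.
have wc : w^* = w^-1 := conj_prim_root _ _ _ wP.
have w0 : w != 0 by rewrite (prim_root_eq0 wP).
transitivity (\sum_(l < n.+1) \sum_(j < n) \sum_(k < n)
    (w ^+ (j + e) / w ^+ k) ^+ l * inner (F (v j)) (G (v k))).
  apply: eq_bigr => l _.
  rewrite (linear_sum F) (linear_sum G) inner_suml mulr_sumr.
  apply: eq_bigr => j _.
  rewrite inner_sumr mulr_sumr; apply: eq_bigr => k _.
  rewrite !linearZ /= linearZl_LR linearZr_LR /= !rmorphXn /= wc.
  have -> : (w ^+ (j + e) / w ^+ k) ^+ l =
      (w ^+ l) ^+ e * (w ^+ l) ^+ j * (w^-1 ^+ l) ^+ k.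
    by rewrite exprMn !exprVn -!exprM -exprD -mulnDr (addnC e) !(mulnC l).
  by rewrite -[LHS]/(_ * _) -!mulrA mulrCA; congr (_ * _); rewrite mulrCA.
rewrite exchange_big mulr_sumr; apply: eq_bigr => j _ /=.
rewrite exchange_big mulr_sumr [RHS]big_mkcond; apply: eq_bigr => k _ /=.
rewrite -mulr_suml; case: ifPn => [/eqP ->|jk].
  rewrite divff ?expf_neq0//; congr (_ * _).
  rewrite (eq_bigr (fun=> 1)) => [|l _]; last by rewrite expr1n.
  by rewrite sumr_const card_ord.
rewrite sum_expr_unity_root ?mul0r//.
  rewrite expr_div_n -!exprM !(mulnC _ n.+1) !exprM (prim_expr_order wP).
  by rewrite !expr1n divr1.
apply: contraNneq jk => /(canRL (divfK (expf_neq0 k w0))).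
rewrite mul1r => /eqP.
rewrite (eq_prim_root_expr wP) !modn_small//.
  exact: leqW.
by rewrite ltnS (leq_trans (leq_add (leqnn j) e1))// addn1.
Qed.

(** The average with [e = 1] isolates the band, the one with [e = 0] the squared norms. The
    hypothesis applies to each averaged vector, and the phases have modulus 1. *)
Lemma inner_band_le F G m v (r : C) :
  (forall h, `|inner (F h) (G h)| <= r * `|h| ^+ 2) ->
  `|\sum_(j < m) inner (F (v j)) (G (v j.+1))| <=
    r * \sum_(j < m.+1) `|v j| ^+ 2.
Proof.
move=> FGr.
have n0 : m.+2%:R != 0 :> C by rewrite pnatr_eq0.
have [w wP] := closed_prim_root_exists _ _ n0.
have := fourier_inner F G v m.+1 1 w isT wP.
have := fourier_inner idfun idfun v m.+1 0 w isT wP.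
set h := fun l : nat => _ => /= E0 E1.
have {}E1 : \sum_(l < m.+2) (w ^+ l) * inner (F (h l)) (G (h l)) =
    m.+2%:R * \sum_(j < m) inner (F (v j)) (G (v j.+1)).
  rewrite -(sum_band _ (fun j k => inner (F (v j)) (G (v k)))).
  apply: (etrans E1).
  by congr (_ * _); apply: eq_bigr => j _; under eq_bigl do rewrite addn1.
have {}E0 : \sum_(l < m.+2) `|h l| ^+ 2 = m.+2%:R * \sum_(j < m.+1) `|v j| ^+ 2.
  under eq_bigr do rewrite -inner_normE.
  under [in RHS]eq_bigr do rewrite -inner_normE.
  transitivity (\sum_(l < m.+2) (w ^+ l) ^+ 0 * inner (h l) (h l)).
    by apply: eq_bigr => l _; rewrite expr0 mul1r.
  rewrite E0; congr (_ * _); apply: eq_bigr => j _.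
  by rewrite (big_pred1 j)// => k; rewrite addn0 eq_sym.
have n_gt0 : 0 < m.+2%:R :> C by rewrite ltr0n.
rewrite -(ler_pM2l n_gt0) mulrCA -E0 -[X in X * _](gtr0_norm n_gt0) -normrM -E1.
rewrite mulr_sumr (le_trans (ler_norm_sum _ _ _))//; apply: ler_sum => l _.
by rewrite normrM normrX (norm_prim_root _ _ _ wP) expr1n mul1r FGr.
Qed.

(** * Real-valued norms and the numerical radius *)

Local Open Scope complex_scope.

Lemma rnormE (V : normedZmodType C) (x : V) : `|x| = (rnorm x)%:C.
Proof. by rewrite /rnorm RRe_real// normr_real. Qed.

Lemma rnorm_ge0 (V : normedZmodType C) (x : V) : 0 <= rnorm x.
Proof. by rewrite -ler0c -rnormE. Qed.

Lemma rnorm_gt0 (V : normedZmodType C) (x : V) : (0 < rnorm x) = (x != 0).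
Proof. by rewrite -(ltcR 0) -rnormE normr_gt0. Qed.

Lemma inner_self (h : H) : inner h h = (rnorm h ^+ 2)%:C.
Proof. by rewrite inner_normE rnormE rmorphXn. Qed.

Lemma innerZ (a b : R) (g h : H) :
  inner (a%:C *: g) (b%:C *: h) = (a * b)%:C * inner g h.
Proof.
rewrite linearZl_LR linearZr_LR /= conj_Creal; last by rewrite complex_real.
by rewrite mulrA -rmorphM.
Qed.

Lemma rnormZ (a : R) (h : H) : 0 <= a -> rnorm (a%:C *: h) = a * rnorm h.
Proof.
move=> a0; apply: complexI; rewrite -rnormE normrZ ger0_norm ?ler0c//.
by rewrite rmorphM /= -rnormE.
Qed.

(** Cauchy-Schwarz, from the nonnegative squared norm of the component of [g] orthogonal to [h]. *)
Lemma rnorm_inner_le (g h : H) : rnorm h = 1 -> rnorm (inner g h) <= rnorm g.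
Proof.
move=> h1.
have: 0 <= inner (g - inner g h *: h) (g - inner g h *: h) by exact: dnorm_ge0.
have -> : inner (g - inner g h *: h) (g - inner g h *: h) =
    (rnorm g ^+ 2 - rnorm (inner g h) ^+ 2)%:C.
  rewrite dnormB dnormZ !inner_self h1 expr1n mulr1 linearZr_LR /=.
  rewrite [_^* * _]mulrC -normCK.
  rewrite conj_Creal ?rpredX ?normr_real// rnormE.
  rewrite -!rmorphXn -rmorphD -rmorphD -rmorphB /=.
  by congr (_%:C); ring.
by rewrite ler0c subr_ge0 ler_pXn2r// nnegrE rnorm_ge0.
Qed.

(** Homogeneity reduces to a unit vector; boundedness of [A] makes the [sup] a genuine upper
    bound. *)
Lemma numerical_radius_inner A (r : R) :
  bounded_op A -> numerical_radius A <= r ->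
  forall h, `|inner (A h) h| <= r%:C * `|h| ^+ 2.
Proof.
move=> [M AM] Ar h; have [->|h0] := eqVneq h 0.
  by rewrite linear0 !normr0 expr0n mulr0.
pose u := (rnorm h)^-1%:C *: h.
have hgt0 : 0 < rnorm h by rewrite rnorm_gt0.
have hE : h = (rnorm h)%:C *: u.
  by rewrite scalerA -rmorphM mulfV ?gt_eqF// scale1r.
have u1 : rnorm u = 1.
  by rewrite rnormZ ?invr_ge0 ?ltW// mulVf// gt_eqF.
have ur : rnorm (inner (A u) u) <= r.
  apply: le_trans Ar; apply: sup_ubound; last by exists u.
  exists M => _ [k k1 <-]; rewrite (le_trans (rnorm_inner_le _ _ k1))//.
  by rewrite (le_trans (AM k))// k1 mulr1.
have -> : inner (A h) h = `|h| ^+ 2 * inner (A u) u.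
  rewrite {1 2}hE; clearbody u.
  by rewrite (linearZ_LR A) innerZ -expr2 rmorphXn /= -rnormE.
rewrite normrM normrX normr_id mulrC ler_wpM2r ?exprn_ge0//.
by rewrite rnormE lecR.
Qed.

(** * Weighted orbits and the bound on a single ratio *)

(** [A] maps [a j] to [a j.+1] and [B] maps it back, so the bands of [A] and of [B] yield each ratio
    and its inverse; the two band estimates are added. *)
Lemma orbit_band_le A B (r : R) (a : nat -> H) (d : nat -> R) m :
  bounded_op A -> bounded_op B -> numerical_radius A <= r ->
  numerical_radius B <= r -> cancel A B ->
  (forall j, A (a j) = a j.+1) -> (forall j, a j != 0) ->
  \sum_(j < m) d j * d j.+1 *
    (rnorm (a j.+1) / rnorm (a j) + rnorm (a j) / rnorm (a j.+1)) <=
  2 * r * \sum_(j < m.+1) d j ^+ 2.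
Proof.
move=> bA bB Ar Br AK aS a0.
pose v j := (d j / rnorm (a j))%:C *: a j.
have n0 j : rnorm (a j) != 0 by rewrite gt_eqF// rnorm_gt0.
have vn j : `|v j| ^+ 2 = (d j ^+ 2)%:C.
  rewrite -inner_normE /v innerZ inner_self -rmorphM; congr (_%:C).
  by field; exact: n0.
have vs : \sum_(j < m.+1) `|v j| ^+ 2 = (\sum_(j < m.+1) d j ^+ 2)%:C.
  by rewrite rmorph_sum; apply: eq_bigr => j _; rewrite vn.
have vA j : inner (A (v j)) (v j.+1) =
    (d j * d j.+1 * (rnorm (a j.+1) / rnorm (a j)))%:C.
  rewrite /v (linearZ_LR A) aS innerZ inner_self -rmorphM; congr (_%:C).
  by field; rewrite !n0.
have vB j : inner (v j) (B (v j.+1)) =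
    (d j * d j.+1 * (rnorm (a j) / rnorm (a j.+1)))%:C.
  rewrite /v (linearZ_LR B) -aS AK innerZ inner_self -rmorphM; congr (_%:C).
  by field; rewrite aS !n0.
(* This is the conjugate of [inner (B h) h]. *)
have hB h : `|inner h (B h)| <= r%:C * `|h| ^+ 2.
  by rewrite hermC expr0 mul1r norm_conjC; exact: numerical_radius_inner.
have := lerD (inner_band_le A idfun m v _ (numerical_radius_inner _ _ bA Ar))
  (inner_band_le idfun B m v _ hB).
rewrite vs; under eq_bigr do rewrite vA.
under [X in _ + `|X|]eq_bigr do rewrite vB.
rewrite -!rmorph_sum -!rmorphM -rmorphD /=.
set S1 := \sum_(j < m) _; set S2 := \sum_(j < m) _.
(* The modulus of an embedded real [a] has unfolded to the root of [a ^+ 2 + 0 ^+ 2]. *)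
rewrite !expr0n !addr0 !sqrtr_sqr -rmorphD lecR => h12.
under eq_bigr do rewrite mulrDr.
rewrite big_split/= -/S1 -/S2.
by rewrite -mulrA mulr_natl mulr2n (le_trans _ h12)// lerD ?ler_norm.
Qed.

(** The orbit starts at [iter N B x], which puts [x] at index [N] and [A x] at [N.+1], with [N]
    further vectors on either side. *)
Lemma ratio_band_le A B (r q : R) (x : H) N :
  bounded_op A -> bounded_op B -> numerical_radius A <= r ->
  numerical_radius B <= r -> inverse_op A B -> x != 0 -> 0 <= q ->
  4 * q * \sum_(j < N) (q ^+ 2) ^+ j +
    (rnorm (A x) / rnorm x + rnorm x / rnorm (A x)) <=
  4 * r * \sum_(j < N.+1) (q ^+ 2) ^+ j.
Proof.
move=> bA bB Ar Br [AK BK] x0 q0.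
pose a j := iter j A (iter N B x).
have A0 y : y != 0 -> A y != 0.
  by apply: contra_neq => Ay0; rewrite -(AK y) Ay0 linear0.
have B0 y : y != 0 -> B y != 0.
  by apply: contra_neq => By0; rewrite -(BK y) By0 linear0.
have a0 j : a j != 0.
  rewrite /a; elim: j => [/=|j]; last exact: A0.
  by elim: (N) => //= n; exact: B0.
have aN : a N = x.
  rewrite /a; elim: (N) => // n IH.
  by rewrite iterSr iterS BK.
(* By truncated subtraction the exponent is the distance from j to {N, N.+1}. *)
pose d j := q ^+ ((N - j) + (j - N.+1)).
have := orbit_band_le A B r a d (N + N.+1) bA bB Ar Br AK (fun=> erefl) a0.
set S := \sum_(j < _) _; have S_ge : 2 * (2 * q * \sum_(j < N) (q ^+ 2) ^+ j) +
    (rnorm (A x) / rnorm x + rnorm x / rnorm (A x)) <= S.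
  (* Only the link from [x] to [A x] keeps its exact ratio term; the others are lowered to 2. *)
  pose f j := d j * d j.+1 * (if j == N then
    rnorm (A x) / rnorm x + rnorm x / rnorm (A x) else 2).
  apply: (@le_trans _ _ (\sum_(j < N + N.+1) f j)); last first.
    apply: ler_sum => j _; rewrite /f.
    case: eqP => [->|_]; first by rewrite -aN.
    rewrite ler_wpM2l ?mulr_ge0 ?exprn_ge0//.
    set u := rnorm _; set w := rnorm _.
    have u0 : 0 < u by rewrite rnorm_gt0.
    have w0 : 0 < w by rewrite rnorm_gt0.
    rewrite -subr_ge0.
    have -> : u / w + w / u - 2 = (u - w) ^+ 2 / (u * w).
      by field; rewrite !gt_eqF.
    by rewrite divr_ge0 ?sqr_ge0 ?mulr_ge0 ?ltW.
  rewrite (sum_two_sided _ f (fun j => 2 * q * (q ^+ 2) ^+ j)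
    (rnorm (A x) / rnorm x + rnorm x / rnorm (A x))).
  - by rewrite -mulr_sumr mulr_natl.
  - move=> j jN; rewrite /f /d ifF; last by apply/eqP; lia.
    rewrite -exprD mulrC -mulrA; congr (_ * _); rewrite -exprM -exprS.
    by congr (_ ^+ _); lia.
  - move=> j jN; rewrite /f /d ifF; last by apply/eqP; lia.
    rewrite -exprD mulrC -mulrA; congr (_ * _); rewrite -exprM -exprS.
    by congr (_ ^+ _); lia.
  - by rewrite /f /d eqxx !subnn (eqP (leqnSn N)) !expr0 !mul1r.
move=> /(le_trans S_ge); rewrite !mulrA -natrM => /le_trans; apply.
(* Cutting between [x] and [A x] leaves two mirror copies of the same geometric sum. *)
rewrite -addSn big_split_ord /=.
have -> : \sum_(j < N.+1) d j ^+ 2 = \sum_(j < N.+1) (q ^+ 2) ^+ j.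
  rewrite (reindex_inj rev_ord_inj); apply: eq_bigr => j _ /=.
  by rewrite /d -!exprM; congr (_ ^+ _); have := ltn_ord j; lia.
have -> : \sum_(j < N.+1) d (N.+1 + j)%N ^+ 2 = \sum_(j < N.+1) (q ^+ 2) ^+ j.
  by apply: eq_bigr => j _; rewrite /d -!exprM; congr (_ ^+ _); lia.
lra.
Qed.

(** Multiplying by [1 - q ^+ 2] closes the geometric sums; the truncation error is a multiple of
    [(q ^+ 2) ^+ N] and vanishes in the limit. *)
Lemma ratio_le A B (r q : R) (x : H) :
  bounded_op A -> bounded_op B -> numerical_radius A <= r ->
  numerical_radius B <= r -> inverse_op A B -> x != 0 -> 0 <= q < 1 ->
  (rnorm (A x) / rnorm x + rnorm x / rnorm (A x)) * (1 - q ^+ 2) <= 4 * (r - q).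
Proof.
move=> bA bB Ar Br AB x0 /andP[q0 q1].
set rho := (X in X * _ <= _).
have q2 : 0 < 1 - q ^+ 2 by rewrite subr_gt0 expr_lt1.
have geom N : (\sum_(j < N) (q ^+ 2) ^+ j) * (1 - q ^+ 2) = 1 - (q ^+ 2) ^+ N.
  by rewrite mulrC -[LHS]opprK -mulNr opprB -subrX1 opprB.
have bound N : rho * (1 - q ^+ 2) - 4 * (r - q) <=
    (4 * q - 4 * r * q ^+ 2) * (q ^+ 2) ^+ N.
  have := ratio_band_le A B r q x N bA bB Ar Br AB x0 q0.
  rewrite -/rho -(ler_pM2r q2) mulrDl -!mulrA !geom (exprS (q ^+ 2)).
  by move: ((q ^+ 2) ^+ N) => Q; lra.
rewrite -subr_le0.
have cvg0 : ((fun N => (4 * q - 4 * r * q ^+ 2) * (q ^+ 2) ^+ N)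
    @ \oo --> (0 : R))%classic.
  rewrite -[X in (_ --> X)%classic](mulr0 (4 * q - 4 * r * q ^+ 2)).
  apply: cvgMr; apply: cvg_expr.
  by rewrite ger0_norm ?sqr_ge0// expr_lt1.
rewrite -(cvg_lim (@Rhausdorff R) cvg0).
apply: limr_ge; first by apply/cvg_ex; exists 0.
by near=> N; exact: bound.
Unshelve. all: by end_near.
Qed.

End HilbertOperators.

(** * Inequalities for [s + s^-1], and the choice of [q] *)

Lemma le_of_add_inv_le (R : rcfType) (s t : R) : 0 < s -> 0 <= t <= 1 ->
  (s + s^-1) * (2 - t) <= 2 * t + 4 -> s <= 1 + Num.sqrt (2 * t) + 5 * t.
Proof.
move=> s0 /andP[t0 t1] st.
have p0 : 0 <= Num.sqrt (2 * t) by rewrite sqrtr_ge0.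
have p2 : Num.sqrt (2 * t) ^+ 2 = 2 * t by rewrite sqr_sqrtr// mulr_ge0.
move: (Num.sqrt _) p0 p2 => p p0 p2.
(* The slack after multiplying by [2 - t] is [2 * t ^+ 2 * (1 - t)]. *)
have {}st : s + s^-1 <= 2 * (1 + t + t ^+ 2).
  have t2 : 0 < 2 - t by lra.
  rewrite -(ler_pM2r t2) (le_trans st)//.
  have := mulr_ge0 (sqr_ge0 t) (_ : 0 <= 1 - t); nra.
have {}st : s ^+ 2 + 1 <= 2 * (1 + t + t ^+ 2) * s.
  by rewrite -(ler_pM2r s0) mulrDl mulVf ?gt_eqF -?expr2 in st.
(* Completing the square bounds the left side by [(1 + t + t ^+ 2) ^+ 2 - 1], which is at most
   [2 * t + 6 * t ^+ 2]. *)
have sq : (s - (1 + t + t ^+ 2)) ^+ 2 <= (p + 3 * t) ^+ 2.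
  have -> : (p + 3 * t) ^+ 2 = 2 * t + 9 * t ^+ 2 + 6 * (p * t).
    by rewrite -p2; ring.
  have pt : 0 <= p * t by rewrite mulr_ge0.
  have t3 : t ^+ 3 <= t ^+ 2 by rewrite exprS ler_piMl ?sqr_ge0.
  have t4 : t ^+ 4 <= t ^+ 2.
    by rewrite (exprD _ 2 2) ler_piMl ?sqr_ge0 ?expr_le1.
  nra.
have : s - (1 + t + t ^+ 2) <= p + 3 * t.
  have [//|h] := lerP; exfalso; move: sq; apply/negP; rewrite -ltNge.
  by rewrite ltr_pXn2r// nnegrE ?(le_trans _ (ltW h))// addr_ge0// mulr_ge0.
have : t ^+ 2 <= t by rewrite expr2 ler_piMl.
lra.
Qed.

Lemma le1_of_add_inv_le (R : realFieldType) (s : R) : 0 < s ->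
  (forall t, 0 < t <= 1 -> (s + s^-1) * (2 - t) <= 2 * t + 4) -> s <= 1.
Proof.
move=> s0 st; rewrite leNgt; apply/negP => s1.
have sV : s * s^-1 = 1 by rewrite mulfV ?gt_eqF.
have c0 : 0 < s + s^-1 - 2.
  have : 0 < (s - 1) ^+ 2 * s^-1.
    by rewrite mulr_gt0 ?invr_gt0// exprn_gt0// subr_gt0.
  have -> : (s - 1) ^+ 2 * s^-1 = s * (s * s^-1) - 2 * (s * s^-1) + s^-1.
    by ring.
  by rewrite sV; lra.
move: (s + s^-1) c0 st => u c0 st.
(* The hypothesis on [t] reads [2 * (u - 2) <= t * (u + 2)]; this [t] is half the threshold. *)
have t01 : 0 < (u - 2) / (u + 2) <= 1.
  by rewrite divr_gt0 ?ler_pdivrMr; lra.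
have := st _ t01.
have : (u - 2) / (u + 2) * (u + 2) = u - 2 by rewrite divfK//; lra.
by move: (_ / _) => t; lra.
Qed.

Theorem corollary1p2 (R : realType) :
  exists C eps0 : R, [/\ 0 < C, 0 < eps0 &
    forall eps : R, 0 <= eps <= eps0 ->
      (psi (1 + eps) <=
         (1 + (8 * eps) `^ (4^-1) + C * eps `^ (2^-1))%:E)%E].
Proof.
(* [eps <= 1 / 2] ensures [Num.sqrt (2 * eps) <= 1]; 8 exceeds 5 times the root of 2. *)
exists 8, (1 / 2); split=> [||eps /andP[eps0 eps1]]; [lra | lra |].
apply: ge_ereal_sup => _ [H [A [B [[bA bB AB] [Ar Br ->]]]]]; rewrite lee_fin.
rewrite /op_norm; set S := (X in sup X).
(* The zero space has no unit vector, and [sup] then takes the value 0. *)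
have [->|S0] := eqVneq S set0.
  by rewrite sup0 !addr_ge0 ?mulr_ge0 ?powR_ge0.
apply: ge_sup; first exact/set0P.
move=> _ [x x1 <-] /=.
have x0 : x != 0 by rewrite -rnorm_gt0 x1.
have s0 : 0 < rnorm (A x).
  rewrite rnorm_gt0; apply: contra_neq x0 => Ax0.
  by rewrite -(proj1 AB x) Ax0 linear0.
(* This is the ratio bound for [q = 1 - t] divided by [t], as [1 - q ^+ 2 = (2 - t) * t] and
   [r - q = eps + t]. *)
have key (t : R) : 0 < t <= 1 -> eps <= t ^+ 2 / 2 ->
    (rnorm (A x) + (rnorm (A x))^-1) * (2 - t) <= 2 * t + 4.
  move=> /andP[t0 t1] et.
  have q01 : 0 <= 1 - t < 1 by apply/andP; split; lra.
  have := ratio_le A B (1 + eps) (1 - t) x bA bB Ar Br AB x0 q01.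
  rewrite x1 divr1 div1r.
  have -> : 1 - (1 - t) ^+ 2 = (2 - t) * t by ring.
  rewrite mulrA => h; rewrite -(ler_pM2r t0) (le_trans h)//.
  nra.
(* The choice t = sqrt (2 eps) below would give q = 1 when eps = 0, so in that
   case t tends to 0 instead. *)
have [e0|e_neq0] := eqVneq eps 0.
  rewrite (@le_trans _ _ 1)//; last first.
    by rewrite -addrA lerDl addr_ge0 ?mulr_ge0 ?powR_ge0.
  apply: le1_of_add_inv_le => // t t01; apply: key => //.
  by rewrite e0 divr_ge0 ?sqr_ge0.
have e_gt0 : 0 < eps by rewrite lt_neqAle eq_sym e_neq0.
pose t : R := Num.sqrt (2 * eps).
have t2 : t ^+ 2 = 2 * eps by rewrite sqr_sqrtr// mulr_ge0.
have t_gt0 : 0 < t by rewrite sqrtr_gt0 mulr_gt0.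
have t1 : t <= 1 by rewrite -(expr_le1 (ltn0Sn 1) (ltW t_gt0)) t2; lra.
have t01 : 0 < t <= 1 by rewrite t_gt0.
have := key t t01; rewrite t2 mulrC mulKf// => /(_ (lexx _)).
move=> /le_of_add_inv_le => /(_ s0); rewrite (ltW t_gt0) t1 => /(_ isT).
move=> /le_trans; apply.
(* Since [8 * eps = (2 * t) ^+ 2], two successive square roots give the fourth root. *)
have -> : Num.sqrt (2 * t) = (8 * eps) `^ 4^-1.
  have -> : 4^-1 = 2^-1 * 2^-1 :> R by rewrite -invfM -natrM.
  have -> : 8 * eps = (2 * t) ^+ 2 by rewrite exprMn t2; ring.
  rewrite powRrM !powR12_sqrt ?sqrtr_ge0 ?sqr_ge0// sqrtr_sqr.
  by rewrite ger0_norm ?mulr_ge0 ?ltW.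
rewrite lerD2l.
have -> : t = Num.sqrt 2 * eps `^ 2^-1.
  by rewrite /t sqrtrM// powR12_sqrt.
rewrite mulrA ler_wpM2r ?powR_ge0//.
have : Num.sqrt 2 <= 3/2 :> R.
  by rewrite -(@ler_pXn2r _ 2)// ?nnegrE ?sqr_sqrtr//; lra.
lra.
Qed.
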